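(* Let $\eta\in(0,1)$ be irrational, let $X=\mathbb{T}=\mathbb{R}/\mathbb{Z}$ (identified with $[0,1)$) with its Borel $\sigma$-algebra $\mathcal{B}$ and normalized Lebesgue measure $\lambda$, and let $T(x)=x+\eta\pmod 1$. Let $\alpha\in(0,1)$ be irrational, and let $A$ be the matrix cocycle over $T$ generated by \[ A(1,x)=\begin{bmatrix}\cos(\pi\alpha)&-\sin(\pi\alpha)\\ \sin(\pi\alpha)&\cos(\pi\alpha)\end{bmatrix}\ \text{ for } x\in[0,1-\eta),\qquad A(1,x)=\begin{bmatrix}1&0\\0&-1\end{bmatrix}\ \text{ for } x\in[1-\eta,1). \] Then the trivial bundle $X\times\mathbb{C}^2$ is irreducible for the cocycle $A$ over $(\mathbb{T},\mathcal{B},\lambda,T)$.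
   Context: The cocycle generated by $A(1,\cdot)$ is $A(0,x)=I$, $A(n,x)=A(1,T^{n-1}(x))\cdots A(1,x)$ and $A(-n,x)=A(1,T^{-n}(x))^{-1}\cdots A(1,T^{-1}(x))^{-1}$ for $n>0$. An invariant (measurable) vector bundle in $X\times\mathbb{C}^2$ for $A$ is given by a measurable map $x\mapsto V(x)$ into complex subspaces of $\mathbb{C}^2$ (measurable with respect to the Grassmannian) for which there is a $T$-invariant set $\tilde X\subset X$ of full measure such that $A(1,x)V(x)=V(T(x))$ for all $x\in\tilde X$. An invariant bundle $V$ is reducible if there is an invariant vector bundle $W$ with $\{0\}\subsetneq W(x)\subsetneq V(x)$ for almost every $x$; otherwise it is irreducible. $X\times\mathbb{C}^2$ denotes the trivial bundle $V(x)=\mathbb{C}^2$. *)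

(* Defs.v *)
From HB Require Import structures.
From mathcomp Require Import all_boot all_order all_algebra.
From mathcomp Require Import all_classical all_reals all_analysis.
From mathcomp Require Import complex.

Set Implicit Arguments.
Unset Strict Implicit.
Unset Printing Implicit Defensive.

Import Order.TTheory GRing.Theory Num.Theory.
Import numFieldNormedType.Exports.

Local Open Scope classical_set_scope.
Local Open Scope ring_scope.

Definition grassmannian (C : numClosedFieldType) (n : nat) := {vspace 'cV[C]_n}.

HB.instance Definition _ (C : numClosedFieldType) (n : nat) :=
  Choice.on (grassmannian C n).
HB.instance Definition _ (C : numClosedFieldType) (n : nat) :=
  isPointed.Build (grassmannian C n) 0%VS.

Definition colspan (C : numClosedFieldType) (n k : nat) (M : 'M[C]_(n, k)) :
    grassmannian C n :=
  limg (linfun (mulmx M : 'cV[C]_k -> 'cV[C]_n)).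

(* The disjoint union over k of the Gr(k, n), each with the quotient topology
   of the n x k matrices of full column rank (an open subset of all n x k
   matrices) under [colspan]. *)
Definition grassmannian_open (C : numClosedFieldType) (n : nat) :
    set (set (grassmannian C n)) :=
  [set U | forall k : nat,
    open [set M : 'M[C]_(n, k) | \rank M = k /\ U (colspan M)]].

Definition borel_grassmannian (C : numClosedFieldType) (n : nat) :=
  g_sigma_algebraType (@grassmannian_open C n).

Fixpoint cocycle_nat (X : Type) (C : numClosedFieldType) (n : nat)
    (T : X -> X) (a : X -> 'M[C]_n) (m : nat) (x : X) : 'M[C]_n :=
  if m is m'.+1 then a (iter m' T x) *m cocycle_nat T a m' x else 1%:M.

(* [Tinv] is the inverse of [T]. For m > 0 the negative branch is
   A(-m, x) = a(T^-m x)^-1 * ... * a(T^-1 x)^-1. *)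
Definition cocycle (X : Type) (C : numClosedFieldType) (n : nat)
    (T Tinv : X -> X) (a : X -> 'M[C]_n) (m : int) (x : X) : 'M[C]_n :=
  match m with
  | Posz p => cocycle_nat T a p x
  | Negz p => cocycle_nat Tinv (fun y => invmx (a (Tinv y))) p.+1 x
  end.

Section Bundles.
Context (d : measure_display) (X : measurableType d) (R : realType)
  (C : numClosedFieldType) (n : nat).

(* The phase space is the measurable subset [D] of [X], with the measure [mu]
   restricted to it; [T] is only relevant on [D], which it maps to itself. *)
Variables (mu : {measure set X -> \bar R}) (D : set X) (T : X -> X)
  (A : int -> X -> 'M[C]_n).

Definition invariant_bundle (V : X -> borel_grassmannian C n) : Prop :=
  measurable_fun D V /\
  exists D' : set X,
    [/\ D' `<=` D, measurable D', mu (D `\` D') = 0%E,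
        D `&` T @^-1` D' = D' &
        forall x, D' x ->
          (linfun (mulmx (A 1 x) : 'cV[C]_n -> 'cV[C]_n) @: V x)%VS = V (T x)].

Definition reducible_bundle (V : X -> borel_grassmannian C n) : Prop :=
  exists W : X -> borel_grassmannian C n,
    invariant_bundle W /\
    {ae mu, forall x, D x ->
      [/\ W x != 0%VS, (W x <= V x)%VS & W x != V x]}.

Definition irreducible_bundle (V : X -> borel_grassmannian C n) : Prop :=
  invariant_bundle V /\ ~ reducible_bundle V.

End Bundles.

Definition trivial_bundle (X : Type) (C : numClosedFieldType) (n : nat) (x : X) :
    borel_grassmannian C n :=
  fullv.

(* x + eta (mod 1), with values in [0, 1). *)
Definition rotation (R : realType) (eta x : R) : R :=
  x + eta - (Num.floor (x + eta))%:~R.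

Definition mx2 (K : Type) (a b c d : K) : 'M[K]_2 :=
  \matrix_(i, j) if i == ord0 then if j == ord0 then a else b
                 else if j == ord0 then c else d.

Definition generator (R : realType) (eta alpha x : R) : 'M[R[i]]_2 :=
  map_mx (real_complex R)
    (if x < 1 - eta
     then mx2 (cos (pi * alpha)) (- sin (pi * alpha))
              (sin (pi * alpha)) (cos (pi * alpha))
     else mx2 1 0 0 (-1)).

(* Main.v *)
Require Import Defs.
From HB Require Import structures.
From mathcomp Require Import all_boot all_order all_algebra.
From mathcomp Require Import all_classical all_reals all_analysis.
From mathcomp Require Import complex.
From mathcomp Require Import measurable_realfun.
From mathcomp Require Import zify ring lra.

(** Why the trivial bundle is irreducible.  A proper nonzero invariant subbundle
    is a measurable field of complex lines in C^2.  The Hopf coordinates turn a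
    line into a unit vector (f1, f2, f3) of R^3: the plane rotation by theta
    becomes the rotation of (f1, f2) by 2 theta with f3 fixed, and diag(1, -1)
    becomes (f1, - f2, - f3) ([generator_rays], [bloch_sphere]).  The reflection
    is applied exactly when the orbit x + n eta passes an integer, so the parity of
    floor (x + n eta) records the number of reflections.  With
    w = (-1) ^ floor (x + n eta), n steps multiply f3 by w and take (f1, f2) to a
    vector (f1', f2') such that (f1', w f2') is (f1, f2) rotated by 2 pi alpha M.
    Up to a correction by 1 when w = -1, the integer M is the sum of the square
    wave (-1) ^ floor (x + j eta) over j < n ([bloch_iter]).

    Two kinds of almost-periods of T contradict this.
    - If q eta is close to an odd integer, then T^q is close to the identity but
      changes the sign of f3; hence f3 is close to 0.
    - If q is odd and q eta is within 4 / q of an even integer 2 p, then T^q is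
      close to the identity and rotates (f1, f2) by 2 pi alpha M.  Here M is a sum
      of q signs, hence odd, and it is bounded by the Denjoy-Koksma argument,
      because the wave has period 2, mean zero and bounded variation
      ([denjoy_koksma_wave]).  As alpha is irrational, the rotations with
      0 < |M| <= 20 stay away from the identity ([cos_gap]); hence (f1, f2) is
      close to 0.
    The two conclusions are incompatible on the unit sphere.

    Closeness of T^q to the identity is used through a set E of positive measure on
    which f1, f2, f3 nearly do not vary ([small_oscillation]): every small
    translation takes some point of E back into E ([steinhaus]).  The almost-periods
    come from Dirichlet's theorem: [odd_numerator] and [odd_denominator]. *)

Import Order.TTheory GRing.Theory Num.Theory.
Import numFieldNormedType.Exports.
Local Open Scope classical_set_scope.
Local Open Scope ring_scope.

Set Implicit Arguments.
Unset Strict Implicit.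
Unset Printing Implicit Defensive.

(** * Diophantine approximation with parity conditions *)

Lemma irrational_gap (R : realType) (b : R) (N : nat) : irrational b ->
  exists2 c : R, 0 < c & forall (q : nat) (p : int), (0 < q <= N)%N ->
    c <= `|q%:R * b - p%:~R|.
Proof.
move=> irr; have {}irr : ~ rational b by [].
elim: N => [|N [c c0 IH]]; first by exists 1 => // -[].
pose y : R := N.+1%:R * b; pose f := y - (Num.floor y)%:~R.
have /andP[fl fu] := floor_itv y.
have f0 : 0 < f.
  rewrite lt_neqAle subr_ge0 fl andbT; apply/eqP => f0; apply: irr.
  apply/rationalP; exists (Num.floor y), N.+1.
  have -> : (Num.floor y)%:~R = y by apply/eqP; rewrite eq_sym -subr_eq0 -/f -f0.
  by rewrite /y mulrAC divff ?mul1r// pnatr_eq0.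
have f1 : f < 1 by rewrite /f ltrBlDl; rewrite intrD in fu.
exists (Num.min c (Num.min f (1 - f))).
  by rewrite !lt_min c0 f0 subr_gt0 f1.
move=> q p /andP[q0]; rewrite leq_eqVlt => /predU1P[->|qN]; last first.
  by rewrite ge_min IH// q0.
rewrite -/y !ge_min; apply/orP; right.
have [pl|pg] := leP (p%:~R : R) (Num.floor y)%:~R.
  by apply/orP; left; rewrite ger0_norm/f; lra.
have : (Num.floor y + 1)%:~R <= p%:~R :> R.
  by rewrite ler_int lezD1 -(ltr_int R).
rewrite intrD => pl; apply/orP; right; rewrite ler0_norm /f; lra.
Qed.

Lemma dirichlet (R : realType) (b : R) (N : nat) : (0 < N)%N ->
  exists (q : nat) (p : int), (0 < q <= N)%N /\ `|q%:R * b - p%:~R| < N%:R^-1.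
Proof.
move=> N0; have N0R : 0 < N%:R :> R by rewrite ltr0n.
pose fr (i : nat) : R := i%:R * b - (Num.floor (i%:R * b))%:~R.
have fr0 i : 0 <= fr i by rewrite subr_ge0 floor_le.
have fr1 i : fr i < 1.
  by rewrite ltrBlDl; have := floorD1_gt (i%:R * b); rewrite intrD.
have cellP (i : 'I_N.+1) : (Num.truncn (N%:R * fr i) < N)%N.
  by rewrite truncn_lt_nat ?mulr_ge0// -[ltRHS]mulr1 ltr_pM2l.
pose cell i : 'I_N := Ordinal (cellP i).
have /injectivePn[i [j ij cij]] : ~~ injectiveb cell.
  by apply/negP => /injectiveP/leq_card; rewrite !card_ord ltnn.
have close : `|fr i - fr j| < N%:R^-1.
  have /andP[il iu] := truncn_itv (mulr_ge0 (ltW N0R) (fr0 i)).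
  have /andP[jl ju] := truncn_itv (mulr_ge0 (ltW N0R) (fr0 j)).
  have e : Num.truncn (N%:R * fr i) = Num.truncn (N%:R * fr j) by case: cij.
  move: il iu jl ju; rewrite e -!natr1 => il iu jl ju.
  rewrite -(ltr_pM2l N0R) divff ?gt_eqF//.
  rewrite -{1}(gtr0_norm N0R) -normrM mulrBr ltr_norml; lra.
wlog ltij : i j {ij cij} close / (j < i)%N.
  move=> H; case: (ltngtP i j) => [lt|lt|eq].
  - by apply: (H j i) => //; rewrite distrC.
  - exact: (H i j).
  - by move: ij; rewrite (val_inj eq) eqxx.
exists (i - j)%N, (Num.floor (i%:R * b) - Num.floor (j%:R * b)); split.
  by rewrite subn_gt0 ltij (leq_trans (leq_subr _ _))// -ltnS.
move: close; rewrite natrB ?(ltnW ltij)// rmorphB/=; congr (`|_| < _).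
rewrite /fr; ring.
Qed.

(** Dividing a Dirichlet approximation by the gcd of its terms keeps both the bound
    on the denominator and the bound on the error. *)
Lemma coprime_dirichlet (R : realType) (b : R) (N : nat) : 0 < b -> (0 < N)%N ->
  exists q p : nat,
    [/\ (0 < q <= N)%N, coprime p q & `|q%:R * b - p%:R| < N%:R^-1].
Proof.
move=> b0 N0; have [q [p [/andP[q0 qN] ap]]] := dirichlet b N0.
have N1 : N%:R^-1 <= 1 :> R by rewrite invf_le1 ?ler1n ?ltr0n.
have p0 : 0 <= p.
  have : -1 < p%:~R :> R.
    have := lt_le_trans ap N1; rewrite ltr_norml => /andP[_].
    have : 0 < q%:R * b by rewrite mulr_gt0 ?ltr0n.
    lra.
  by rewrite (_ : -1 = (-1)%:~R)// ltr_int; lia.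
case: p p0 ap => // p _; rewrite -pmulrn => ap.
have d0 : (0 < gcdn p q)%N by rewrite gcdn_gt0 q0 orbT.
have [k kE] := dvdnP (dvdn_gcdr p q); have [l lE] := dvdnP (dvdn_gcdl p q).
exists k, l; have k0 : (0 < k)%N by move: q0; rewrite kE muln_gt0 => /andP[].
split.
- by rewrite k0/= (leq_trans _ qN)// [leqRHS]kE leq_pmulr.
- by rewrite /coprime -(eqn_pmul2r d0) muln_gcdl -lE -kE mul1n.
- apply: le_lt_trans ap.
  have -> : q%:R * b - p%:R = (k%:R * b - l%:R) * (gcdn p q)%:R.
    by rewrite mulrBl mulrAC -!natrM -kE -lE.
  by rewrite normrM normr_nat ler_peMr// ler1n.
Qed.

(** If the Dirichlet denominator q is even, then p is odd, and the inverse u of p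
    modulo q, with l = (u p - 1) / q, gives the neighbouring fraction l / u: its
    denominator is odd because u p is congruent to 1 modulo the even number q, and
    its distance to p / q is 1 / (u q), which only doubles the error bound.
    Irrationality makes the denominators grow, so the error also tends to 0. *)
Lemma odd_denominator (R : realType) (b e : R) : 0 < b -> irrational b -> 0 < e ->
  exists q p : nat, [/\ odd q, coprime p q,
    `|q%:R * b - p%:R| < e & `|q%:R * b - p%:R| * q%:R <= 2].
Proof.
move=> b0 irr e0; pose K := (Num.truncn (2 / e)).+1.
have [c c0 gap] := irrational_gap K irr.
(* An error below 1 / N < c excludes all denominators up to K. *)
pose N := (Num.truncn c^-1).+1.
have [q [p [/andP[q0 qN] cop ap]]] := coprime_dirichlet b0 (ltn0Sn _ : (0 < N)%N).
have qR : 0 < q%:R :> R by rewrite ltr0n.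
have Kq : (K < q)%N.
  rewrite ltnNge; apply/negP => qK; have := gap q p; rewrite q0 qK => /(_ isT).
  rewrite -pmulrn leNgt (lt_trans ap)// invf_plt ?posrE ?ltr0n//.
  exact: truncnS_gt.
have qe : 2 / q%:R < e.
  rewrite ltr_pdivrMr// mulrC -ltr_pdivrMr//.
  by rewrite (lt_trans (truncnS_gt _))// ltr_nat.
have apq : `|q%:R * b - p%:R| < q%:R^-1.
  by apply: (lt_le_trans ap); rewrite lef_pV2 ?posrE ?ltr0n// ler_nat.
have [oq|eq] := boolP (odd q).
  exists q, p; split => //.
    rewrite (lt_trans apq)// (le_lt_trans _ qe)//.
    by rewrite ler_peMl ?invr_ge0 ?ler0n ?ler1n//.
  by rewrite -ler_pdivlMr// (le_trans (ltW apq))// ler_peMl ?invr_ge0 ?ler0n ?ler1n//.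
have q1 : (1 < q)%N by case: q q0 eq {qN cop ap qR Kq qe apq} => [|[]].
have [u ulq /eqP up] : exists2 u : nat, (u < q)%N & (u * p == 1 %[mod q])%N.
  have p0 : (0 < p)%N.
    by case: p cop {ap apq} => //; rewrite /coprime gcd0n => /eqP q1'; rewrite q1' in q1.
  case: (egcdnP q p0) => u v euv _; exists (u %% q)%N; first by rewrite ltn_mod.
  by rewrite modnMml euv (eqP cop) modnMDl.
pose l := ((u * p) %/ q)%N.
have upE : (u * p = l * q + 1)%N.
  by rewrite {1}(divn_eq (u * p) q) up modn_small.
have uR : u%:R * p%:R = l%:R * q%:R + 1 :> R by rewrite -!natrM upE natrD.
have key : `|u%:R * b - l%:R| <= 2 / q%:R.
  have -> : u%:R * b - l%:R = (u%:R / q%:R) * (q%:R * b - p%:R) + q%:R^-1.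
    have -> : l%:R = (u%:R * p%:R - 1) / q%:R :> R by rewrite uR addrK mulfK ?gt_eqF.
    by field; rewrite gt_eqF.
  apply: (le_trans (ler_normD _ _)); rewrite [X in _ + X]gtr0_norm ?invr_gt0//.
  have -> : 2 / q%:R = q%:R^-1 + q%:R^-1 :> R by ring.
  rewrite lerD2r normrM ger0_norm ?divr_ge0//.
  rewrite (le_trans _ (ltW apq))// ler_piMl// ler_pdivrMr// mul1r ler_nat.
  exact: ltnW.
exists u, l; split.
- have : odd (u * p) by rewrite upE oddD oddM (negbTE eq) andbF.
  by rewrite oddM => /andP[].
- rewrite coprime_sym /coprime -dvdn1; set g := gcdn _ _.
  have gl : (g %| l * q)%N by rewrite dvdn_mulr// dvdn_gcdr.
  by rewrite -(dvdn_addr 1 gl) -upE dvdn_mulr// dvdn_gcdl.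
- exact: le_lt_trans qe.
- rewrite (le_trans (ler_wpM2r (ler0n _ _) key))// mulrAC ler_pdivrMr// ler_wpM2l//.
  by rewrite ler_nat ltnW.
Qed.

(** Approximations of b / 2 by integers would give even numerators for b.  Instead,
    take d = q (b / 2) - p small and nonzero: some multiple k d is close to 1 / 2 or
    to - 1 / 2, so that k q b is close to 2 k p + 1 or to 2 k p - 1. *)
Lemma odd_numerator (R : realType) (b e : R) : irrational b -> 0 < e ->
  exists (q : nat) (p : int), `|q%:R * b - (2 * p + 1)%:~R| < e.
Proof.
move=> irr e0; pose N := (Num.truncn (e / 2)^-1).+1.
have [q [p [q0 ap]]] := dirichlet (b / 2) (ltn0Sn _ : (0 < N)%N).
have [c c0 gap] : exists2 c : R, 0 < c & c <= `|q%:R * (b / 2) - p%:~R|.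
  have irr2 : irrational (b / 2).
    apply: contra_not irr => /rationalP[m [n bE]]; apply/rationalP.
    exists (2 * m), n; rewrite rmorphM/= -mulrA -bE; lra.
  have [c c0 /(_ q p)] := irrational_gap N irr2.
  by rewrite q0 => /(_ isT); exists c.
have Ne : N%:R^-1 < e / 2.
  by rewrite invf_plt ?posrE ?ltr0n ?divr_gt0//; exact: truncnS_gt.
set d := _ - _ in ap gap; have d0 : 0 < `|d| by exact: lt_le_trans gap.
pose k := Num.truncn (2 * `|d|)^-1.
have /andP[kl ku] : k%:R <= (2 * `|d|)^-1 < k.+1%:R.
  by apply: truncn_itv; rewrite invr_ge0 mulr_ge0.
have kd : `|k%:R * (2 * `|d|) - 1| < e.
  have d2 : 0 < 2 * `|d| by rewrite mulr_gt0.
  move: kl ku; rewrite -(ler_pM2r d2) -(ltr_pM2r d2) mulVf ?gt_eqF// -natr1 mulrDl.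
  move=> kl ku; rewrite ltr_norml; move: (lt_trans ap Ne); lra.
have qbE : q%:R * b = 2 * d + 2 * p%:~R by rewrite /d; field.
have [d_ge0|d_lt0] := leP 0 d.
  exists (k * q)%N, (k%:Z * p); move: kd; rewrite (ger0_norm d_ge0).
  rewrite natrM -mulrA qbE !(rmorphD, rmorphM)/= -pmulrn => kd.
  by rewrite (_ : _ - _ = k%:R * (2 * d) - 1)//; ring.
exists (k * q)%N, (k%:Z * p - 1); move: kd; rewrite (ltr0_norm d_lt0) -normrN.
rewrite natrM -mulrA qbE !(rmorphD, rmorphM, rmorphN)/= -pmulrn => kd.
by rewrite (_ : _ - _ = - (k%:R * (2 * - d) - 1))//; ring.
Qed.

(** * The square wave along an orbit of the rotation *)

Definition wave (R : realType) (t : R) : int := (-1) ^ Num.floor t.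

Lemma wave_sign (R : realType) (t : R) : wave t = 1 \/ wave t = -1.
Proof.
rewrite /wave; case: Num.floor => n; rewrite /exprz -signr_odd.
  by case: (odd _); [right|left].
by rewrite -[_ ^+ _]signr_odd; case: (odd _); [right|left].
Qed.

Lemma wave_odd (R : realType) (t : R) : wave (t + 1) = - wave t.
Proof.
rewrite /wave; have -> : Num.floor (t + 1) = Num.floor t + 1.
  by apply: floor_def; have := floor_itv t; rewrite !rmorphD/=; lra.
by rewrite exprzDr// mulrN1.
Qed.

Lemma wave_periodic (R : realType) (t : R) (c : nat) : wave (t + (2 * c)%:R) = wave t.
Proof.
elim: c => [|c IH]; first by rewrite addr0.
have -> : t + (2 * c.+1)%:R = t + (2 * c)%:R + 1 + 1.
  by rewrite mulnS natrD; ring.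
by rewrite !wave_odd opprK.
Qed.

(** Writing the wave through indicators of half-lines reduces its sums to counting
    the points below a level. *)
Lemma wave_steps (R : realType) (t : R) : -1 <= t < 4 ->
  (wave t)%:~R = -1 + 2 * (t < 3)%R%:R - 2 * (t < 2)%R%:R + 2 * (t < 1)%R%:R
                 - 2 * (t < 0)%R%:R :> R.
Proof.
move=> /andP[t0 t4]; rewrite /wave.
have fl (m : int) : m%:~R <= t < (m + 1)%:~R -> Num.floor t = m by exact: floor_def.
have [t0'|t0'] := ltP t 0; have [t1|t1] := ltP t 1; have [t2|t2] := ltP t 2;
  have [t3|t3] := ltP t 3; try (exfalso; lra).
- by rewrite (fl (-1)) /=; [rewrite exprN1 invrN1; ring | lra].
- by rewrite (fl 0) /=; [rewrite expr0z; ring | lra].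
- by rewrite (fl 1) /=; [rewrite expr1z; ring | lra].
- rewrite (fl 2) /=; first by rewrite -exprnP expr2; ring.
  by rewrite t2.
rewrite (fl 3) /=; first by rewrite -exprnP !exprS expr0; ring.
by rewrite t3.
Qed.

Lemma count_below_ge (R : realType) (q : nat) (t : R) :
  Num.min q%:R t <= \sum_(r < q) (r%:R < t)%R%:R.
Proof.
elim: q => [|q IH]; first by rewrite big_ord0 ge_min lexx.
rewrite big_ord_recr/=; case: ltP => qt.
  rewrite ge_min; apply/orP; left; rewrite -natr1 lerD2r.
  by move: IH; rewrite min_l // ltW.
by rewrite addr0 ge_min; apply/orP; right; move: IH; rewrite min_r.
Qed.

Lemma count_below_le (R : realType) (q : nat) (t : R) :
  \sum_(r < q) (r%:R < t)%R%:R <= Num.max 0 (t + 1).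
Proof.
elim: q => [|q IH]; first by rewrite big_ord0 le_max lexx.
rewrite big_ord_recr/=; case: ltP => qt; last by rewrite addr0.
rewrite le_max; apply/orP; right; apply: lerD (lexx 1).
rewrite (le_trans _ (ltW qt))// -[leRHS]mulr1n -[q in leRHS]card_ord.
rewrite -sumr_const; apply: ler_sum => i _; by rewrite lern1 leq_b1.
Qed.

(** The Denjoy-Koksma inequality for the square wave.  Since eta is close to 2 p / q
    and p is prime to q, the points x + j eta modulo 2 are, up to an error of 4 / q,
    the q equally spaced points x + 2 r / q.  Hence the number N c of them below a
    level c differs by a bounded amount from its expected value q (c - x) / 2, and
    by [wave_steps] the sum is an alternating combination of N 0, N 1, N 2, N 3 in
    which the main terms cancel. *)
Lemma denjoy_koksma_wave (R : realType) (eta x : R) (q p : nat) :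
  (0 < q)%N -> coprime p q -> 0 <= x < 1 ->
  `|q%:R * eta - (2 * p)%:R| <= 1 -> `|q%:R * eta - (2 * p)%:R| * q%:R <= 4 ->
  `|\sum_(j < q) wave (x + j%:R * eta)| <= 20.
Proof.
move=> q0 cop /andP[x0 x1] d1 dq; have qR : 0 < q%:R :> R by rewrite ltr0n.
set d := q%:R * eta - _ in d1 dq.
pose r (j : 'I_q) : 'I_q := Ordinal (ltn_pmod (j * p) q0).
have r_inj : injective r.
  move=> i j /(congr1 val)/= /eqP; wlog ij : i j / (i <= j)%N.
    move=> H; have [|/ltnW] := leqP i j; first exact: H.
    by move=> ji; rewrite eq_sym => /(H _ _ ji).
  rewrite eq_sym eqn_mod_dvd ?leq_mul2r ?ij ?orbT// -mulnBl Gauss_dvdl; last first.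
    by rewrite coprime_sym.
  have jiq : (j - i < q)%N by rewrite (leq_ltn_trans (leq_subr _ _)).
  case: (posnP (j - i)) => [/eqP|ji0]; last by rewrite gtnNdvd.
  by rewrite subn_eq0 => ji _; apply/val_inj/eqP; rewrite eqn_leq ij.
(* y j is x + j eta reduced by an even integer, split into the equally spaced
   point x + 2 r / q and a drift of size at most |d|. *)
pose y (j : 'I_q) : R := x + 2 * (r j)%:R / q%:R + j%:R * (d / q%:R).
have yE (j : 'I_q) : x + j%:R * eta = y j + (2 * (j * p %/ q))%:R.
  rewrite /y /d/= !natrM; have := divn_eq (j * p) q => /(congr1 (fun n => n%:R : R)).
  rewrite natrD !natrM => e.
  have -> : (j * p %% q)%:R = j%:R * p%:R - (j * p %/ q)%:R * q%:R :> R.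
    by rewrite e; ring.
  by field; rewrite gt_eqF.
have err (j : 'I_q) : `|j%:R * (d / q%:R)| <= `|d|.
  rewrite mulrCA normrM ler_piMr// ger0_norm ?divr_ge0//.
  by rewrite ler_pdivrMr// mul1r ler_nat ltnW.
have r2 (j : 'I_q) : 2 * (r j)%:R / q%:R <= 2 - 2 / q%:R :> R.
  rewrite ler_pdivrMr// mulrBl divfK ?gt_eqF// -{3}[2]mulr1 -mulrBr ler_wpM2l//.
  by rewrite lerBrDr natr1 ler_nat.
have y_itv (j : 'I_q) : -1 <= y j < 4.
  have := le_trans (err j) d1; have := r2 j; have : 0 <= 2 * (r j)%:R / q%:R :> R.
    by rewrite divr_ge0// mulr_ge0.
  have : 0 < 2 / q%:R :> R by rewrite divr_gt0.
  by rewrite /y ler_norml; set a := 2 * _ / _; set b := j%:R * _; lra.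
pose N (c : R) : R := \sum_(j < q) (y j < c)%R%:R.
have errq (j : 'I_q) : - 4 <= j%:R * (d / q%:R) * q%:R <= 4.
  rewrite -ler_norml normrM [X in _ * X]ger0_norm ?(ltW qR)//.
  by apply: le_trans dq; rewrite ler_wpM2r ?(ltW qR).
have yq (j : 'I_q) : y j * q%:R = x * q%:R + 2 * (r j)%:R + j%:R * (d / q%:R) * q%:R.
  by rewrite /y; field; rewrite gt_eqF.
have Nlo c : Num.min q%:R (q%:R * (c - x) / 2 - 2) <= N c.
  apply: le_trans (count_below_ge _ _) _; rewrite (reindex_inj r_inj)/=.
  apply: ler_sum => j _; case: (ltP _ (q%:R * _ / 2 - 2)) => // rt.
  suff -> : y j < c by [].
  rewrite -(ltr_pM2r qR) yq; move: (errq j) rt => /=; set e := j%:R * _ * _; lra.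
have Nhi c : N c <= Num.max 0 (q%:R * (c - x) / 2 + 3).
  have -> : q%:R * (c - x) / 2 + 3 = q%:R * (c - x) / 2 + 2 + 1 by ring.
  apply: le_trans (count_below_le q _); rewrite [leRHS](reindex_inj r_inj)/=.
  apply: ler_sum => j _; case: (ltP (y j)) => // yc.
  suff -> : (r j)%:R < q%:R * (c - x) / 2 + 2 by [].
  move: yc; rewrite -(ltr_pM2r qR) yq; move: (errq j) => /=; set e := j%:R * _ * _; lra.
have Nq c : 0 <= N c <= q%:R.
  rewrite sumr_ge0//= -[leRHS]mulr1n -[q in leRHS]card_ord.
  by rewrite -sumr_const; apply: ler_sum => i _; by rewrite lern1 leq_b1.
have SE : (\sum_(j < q) wave (x + j%:R * eta))%:~R =
    - q%:R + 2 * N 3 - 2 * N 2 + 2 * N 1 - 2 * N 0.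
  rewrite rmorph_sum/= /N !mulr_sumr -[q in - q%:R]card_ord -sumr_const -sumrN.
  rewrite -!(big_split, sumrB)/=; apply: eq_bigr => j _.
  by rewrite yE wave_periodic wave_steps.
rewrite -(ler_int R) intr_norm SE ler_norml.
have xq : 0 <= x * q%:R by rewrite mulr_ge0// ltW.
have xq1 : x * q%:R <= q%:R by rewrite ler_piMl// ltW.
(* The constants add up to - 20 <= sum <= 10. *)
have lo3 : q%:R - 2 <= N 3.
  by apply: le_trans (Nlo 3); rewrite le_min; apply/andP; split; lra.
have lo2 : q%:R * (2 - x) / 2 - 2 <= N 2.
  by apply: le_trans (Nlo 2); rewrite le_min lexx andbT; lra.
have lo1 : q%:R * (1 - x) / 2 - 2 <= N 1.
  by apply: le_trans (Nlo 1); rewrite le_min lexx andbT; lra.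
have hi2 : N 2 <= q%:R * (2 - x) / 2 + 3.
  by apply: le_trans (Nhi 2) _; rewrite ge_max lexx andbT; lra.
have hi1 : N 1 <= q%:R * (1 - x) / 2 + 3.
  by apply: le_trans (Nhi 1) _; rewrite ge_max lexx andbT; lra.
have hi0 : N 0 <= 3.
  by apply: le_trans (Nhi 0) _; rewrite ge_max; apply/andP; split; lra.
have /andP[lo0 _] := Nq 0; have /andP[_ hi3] := Nq 3.
have -> : (20%:~R : R) = 20 by [].
clear -xq xq1 lo3 lo2 lo1 lo0 hi3 hi2 hi1 hi0.
set n0 := N 0 in lo0 hi0 *; set n1 := N 1 in lo1 hi1 *.
set n2 := N 2 in lo2 hi2 *; set n3 := N 3 in lo3 hi3 *.
by apply/andP; split; lra.
Qed.

(** * Recurrence of sets of positive measure *)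

Lemma lebesgue_measure_shift (R : realType) (d : R) (A : set R) : measurable A ->
  lebesgue_measure ((fun x => x + d) @^-1` A) = lebesgue_measure A.
Proof.
move=> mA.
have mf : measurable_fun setT ((fun x => x + d) : R -> measurableTypeR R).
  exact: measurable_funD.
suff <- : pushforward lebesgue_measure ((fun x => x + d) : R -> measurableTypeR R) A
  = lebesgue_measure A by [].
apply/esym/lebesgue_measure_unique => //= _ [[a b]] _ <-.
rewrite /pushforward.
have -> : (fun x => x + d) @^-1` `]a, b]%classic = `]a - d, b - d]%classic.
  by apply/seteqP; split => x /=; rewrite !in_itv/= ltrBlDr lerBrDr.
rewrite !lebesgue_measure_itv/= !lte_fin ltrD2r.
by case: ifP => // _; rewrite -!EFinB; congr _%:E; ring.
Qed.

(** Steinhaus' theorem: choose K compact inside E and U open around K with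
    U minus K of measure less than that of K.  For small d the translate K + d is
    still inside U and has the measure of K, so it is not contained in U minus K
    and meets K. *)
Lemma steinhaus (R : realType) (E : set R) : measurable E ->
  (0 < lebesgue_measure E)%E -> (lebesgue_measure E < +oo)%E ->
  exists2 r : R, 0 < r & forall d, `|d| < r -> exists2 x, E x & E (x + d).
Proof.
move=> mE E0 Efin.
have Enum : lebesgue_measure E \is a fin_num by rewrite ge0_fin_numE.
have [K [cK KE muEK]] : exists K, [/\ compact K, K `<=` E & (lebesgue_measure (E `\` K) < lebesgue_measure E)%E].
  have m0 : 0 < fine (lebesgue_measure E) by rewrite fine_gt0// E0 Efin.
  have [K [cK KE]] := lebesgue_regularity_inner mE Efin m0.
  by rewrite fineK// => muEK; exists K.
have mK : measurable K by exact: compact_measurable.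
have Kfin : (lebesgue_measure K < +oo)%E.
  by apply: le_lt_trans Efin; apply: le_measure; rewrite ?inE.
have K0 : (0 < lebesgue_measure K)%E.
  rewrite lt0e measure_ge0 andbT; apply/eqP => K0; move: muEK.
  have -> : lebesgue_measure (E `\` K) = (lebesgue_measure E - lebesgue_measure K)%E.
    by rewrite measureD// (setIidr KE).
  by rewrite K0 sube0 ltxx.
have Knum : lebesgue_measure K \is a fin_num by rewrite ge0_fin_numE.
have k0 : 0 < fine (lebesgue_measure K) by rewrite fine_gt0// K0 Kfin.
have [U [oU KU muUK]] := lebesgue_regularity_outer mK Kfin k0.
have : \forall d \near (0 : R), K `<=` [set x | U (x + d)].
  have /compact_near_coveringP nK := cK.
  apply: (nK R (nbhs (0:R)) (fun d x => U (x + d)) _) => x Kx.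
  have nU : nbhs (x + 0) U.
    by rewrite addr0; apply: open_nbhs_nbhs; split => //; exact: KU.
  exact: (add_continuous (x, 0) U nU).
move=> /nbhs_ballP[r /= r0 rU]; exists r => // d dr.
have Ud : K `<=` [set x | U (x + d)].
  by apply: rU; rewrite /ball/= sub0r normrN.
apply: contrapT => noE.
have KdU : (fun x => x - d) @^-1` K `<=` U `\` K.
  move=> x /= Kxd; split; first by have := Ud _ Kxd; rewrite /= subrK.
  by move=> Kx; apply: noE; exists (x - d); [exact: KE|rewrite subrK; exact: KE].
have mKd : measurable ((fun x => x - d) @^-1` K).
  by rewrite -[X in measurable X]setTI; apply: measurable_funD.
move: muUK; rewrite fineK// ltNge => /negP; apply.
rewrite -(lebesgue_measure_shift (- d) mK); apply: le_measure; rewrite ?inE//.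
by apply: measurableD => //; exact: open_measurable.
Qed.

(** Countably many level bands of width e cover E, so one of them has positive
    measure. *)
Lemma small_oscillation (R : realType) (E : set R) (f : R -> R) (e : R) :
  measurable E -> (0 < lebesgue_measure E)%E -> measurable_fun E f -> 0 < e ->
  exists F : set R, [/\ F `<=` E, measurable F, (0 < lebesgue_measure F)%E &
    forall x y, F x -> F y -> `|f x - f y| < e].
Proof.
move=> mE E0 mf e0.
pose P (n : int) : set R := E `&` f @^-1` `[n%:~R * e, (n + 1)%:~R * e[%classic.
have mP n : measurable (P n) by apply: mf => //; exact: measurable_itv.
have osc n x y : P n x -> P n y -> `|f x - f y| < e.
  move=> [_ /=]; rewrite in_itv/= intrD mulrDl mul1r => /andP[? ?] [_ /=].
  by rewrite in_itv/= intrD mulrDl mul1r => /andP[? ?]; rewrite ltr_norml; lra.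
have cover : E = \bigcup_k (if unpickle k is Some n then P n else set0).
  apply/seteqP; split=> [x Ex|x [k _]]; last by case: unpickle => // n [].
  exists (pickle (Num.floor (f x / e))); first exact: I.
  rewrite pickleK; split => //=.
  by rewrite in_itv/= -ler_pdivlMr// -ltr_pdivrMr// floor_itv.
have [[n Pn]|none] := pselect (exists n, (0 < lebesgue_measure (P n))%E).
  by exists (P n); split => //; [move=> x []|exact: osc].
suff : lebesgue_measure E = 0%E by move=> E00; rewrite E00 ltxx in E0.
have null k : lebesgue_measure.-negligible (if unpickle k is Some n then P n else set0).
  case: (unpickle k) => [n|]; last exact: negligible_set0.
  apply/negligibleP; first exact: mP.
  apply/eqP; rewrite -measure_le0 leNgt.
  by apply/negP => Pn; apply: none; exists n.
by apply/negligibleP; rewrite // cover; apply: negligible_bigcup.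
Qed.

(** * Rotations by multiples of an irrational angle *)

Lemma sin_pi_neq0 (R : realType) (y : R) : 0 <= y -> (forall n : nat, y <> n%:R) ->
  sin (pi * y) != 0.
Proof.
move=> y0 yN; have /andP[yl yu] := truncn_itv y0.
pose n := Num.truncn y; pose f := y - n%:R.
have f0 : 0 < f by rewrite subr_gt0 lt_neqAle yl andbT; apply/eqP => /esym/yN.
have f1 : f < 1 by rewrite ltrBlDl natr1.
have sinf : 0 < sin (pi * f).
  by apply: sin_gt0_pi; rewrite mulr_gt0 ?pi_gt0//= gtr_pMr ?pi_gt0.
have E k : `|sin (pi * (f + k%:R))| = `|sin (pi * f)|.
  elim: k => [|k IH]; first by rewrite addr0.
  by rewrite -natr1 addrA mulrDr mulr1 sinDpi normrN.
by rewrite -normr_eq0 -(subrK n%:R y) -/f E normr_eq0 gt_eqF.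
Qed.

(** No nonzero multiple of a is an integer, so each of the finitely many cosines is
    less than 1; the constant c bounds how close a rotation by one of these angles
    is to the identity. *)
Lemma cos_gap (R : realType) (a : R) (B : nat) : 0 < a -> irrational a ->
  exists2 c : R, 0 < c & forall m : int, m != 0 -> `|m| <= B%:Z ->
    cos (m%:~R * (pi * a *+ 2)) <= 1 - c.
Proof.
move=> a0 irr; have {}irr : ~ rational a by [].
suff [c c0 cP] : exists2 c : R, 0 < c & forall m : nat, (0 < m <= B)%N ->
    cos (m%:R * (pi * a *+ 2)) <= 1 - c.
  exists c => // m m0 mB.
  have -> : cos (m%:~R * (pi * a *+ 2)) = cos (`|m|%N%:R * (pi * a *+ 2)).
    case: m {m0 mB} => m; first by rewrite -pmulrn.
    by rewrite NegzE mulrNz mulNr cosN abszN -pmulrn.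
  by apply: cP; move: m0 mB; lia.
elim: B => [|B [c c0 IH]]; first by exists 1 => // -[].
exists (Num.min c (1 - cos (B.+1%:R * (pi * a *+ 2)))).
  rewrite lt_min c0/= mulrnAr cos_mulr2n subr_gt0 -subr_gt0.
  have sn : sin (B.+1%:R * (pi * a)) != 0.
    rewrite mulrCA; apply: sin_pi_neq0; first by rewrite mulr_ge0// ltW.
    move=> n nE; apply: irr; apply/rationalP; exists n%:Z, B.+1.
    by rewrite -pmulrn -nE mulrAC divff ?mul1r// pnatr_eq0.
  have := cos2Dsin2 (B.+1%:R * (pi * a)); have : 0 < sin (B.+1%:R * (pi * a)) ^+ 2.
    by rewrite exprn_even_gt0//= sn.
  lra.
move=> m /andP[m0]; rewrite leq_eqVlt => /predU1P[->|mB].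
  by rewrite lerBrDr -lerBrDl ge_min lexx orbT.
rewrite (le_trans (IH m _)) ?m0//.
by rewrite lerD2l lerN2 ge_min lexx.
Qed.

(** * Lines of C^2 as points of the Bloch sphere *)

Lemma continuous_Re (R : realType) :
  continuous (fun z : (R[i] : numClosedFieldType) => complex.Re z).
Proof.
move=> z A /nbhs_ballP[e /= e0 eA].
apply/nbhs_ballP; exists (e%:C)%C; first by rewrite /= ltcR.
move=> w; rewrite /ball /= => zw; apply: eA; rewrite /ball /=.
by rewrite -ltcR -raddfB; apply: le_lt_trans zw; exact: normc_ge_Re.
Qed.

Lemma continuous_Im (R : realType) :
  continuous (fun z : (R[i] : numClosedFieldType) => complex.Im z).
Proof.
move=> z A /nbhs_ballP[e /= e0 eA].
apply/nbhs_ballP; exists (e%:C)%C; first by rewrite /= ltcR.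
move=> w; rewrite /ball /= => zw; apply: eA; rewrite /ball /=.
rewrite -ltcR -raddfB; apply: le_lt_trans zw.
rewrite normc_def lecR -sqrtr_sqr ler_wsqrtr// lerDr; exact: sqr_ge0.
Qed.

Lemma continuous_add (R : realType) (T : topologicalType) (f g : T -> R) :
  continuous f -> continuous g -> continuous (fun x => f x + g x).
Proof. by move=> cf cg x; apply: cvgD; [exact: cf|exact: cg]. Qed.

Lemma continuous_mul (R : realType) (T : topologicalType) (f g : T -> R) :
  continuous f -> continuous g -> continuous (fun x => f x * g x).
Proof. by move=> cf cg x; apply: cvgM; [exact: cf|exact: cg]. Qed.

Section Bloch.
Variable R : realType.
Local Notation C := (R[i] : numClosedFieldType).
Implicit Types (v : 'cV[C]_2) (L : borel_grassmannian R[i] 2).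

Definition coordRe (i : 'I_2) v : R := complex.Re (v i ord0 : R[i]).
Definition coordIm (i : 'I_2) v : R := complex.Im (v i ord0 : R[i]).

(** The Hermitian form p |v0|^2 + q |v1|^2 + s Re (v0 conj v1) + t Re (i v0 conj v1).
    The squared norm is the form 1, 1, 0, 0, and the three Bloch (Hopf) coordinates
    of the line of v are the forms 1, -1, 0, 0 and 0, 0, 2, 0 and 0, 0, 0, 2 divided
    by it.  Products replace squares so that the continuity lemmas apply. *)
Definition hform (p q s t : R) v : R :=
  p * (coordRe ord0 v * coordRe ord0 v + coordIm ord0 v * coordIm ord0 v)
  + q * (coordRe ord_max v * coordRe ord_max v + coordIm ord_max v * coordIm ord_max v)
  + s * (coordRe ord0 v * coordRe ord_max v + coordIm ord0 v * coordIm ord_max v)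
  + t * (coordRe ord0 v * coordIm ord_max v + - 1 * (coordIm ord0 v * coordRe ord_max v)).

Lemma continuous_coordRe i : continuous (coordRe i).
Proof.
move=> v; apply: (@continuous_comp _ _ _ (fun v : 'cV[C]_2 => v i ord0)
  (fun z : C => complex.Re z)); first exact: coord_continuous.
exact: continuous_Re.
Qed.

Lemma continuous_coordIm i : continuous (coordIm i).
Proof.
move=> v; apply: (@continuous_comp _ _ _ (fun v : 'cV[C]_2 => v i ord0)
  (fun z : C => complex.Im z)); first exact: coord_continuous.
exact: continuous_Im.
Qed.

Lemma continuous_hform p q s t : continuous (hform p q s t).
Proof.
have cst (a : R) : continuous (fun _ : 'cV[C]_2 => a) by exact: cst_continuous.
have r0 := @continuous_coordRe ord0; have r1 := @continuous_coordRe ord_max.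
have i0 := @continuous_coordIm ord0; have i1 := @continuous_coordIm ord_max.
have mm := continuous_mul.
exact: (continuous_add (continuous_add (continuous_add
  (mm _ _ _ _ (cst p) (continuous_add (mm _ _ _ _ r0 r0) (mm _ _ _ _ i0 i0)))
  (mm _ _ _ _ (cst q) (continuous_add (mm _ _ _ _ r1 r1) (mm _ _ _ _ i1 i1))))
  (mm _ _ _ _ (cst s) (continuous_add (mm _ _ _ _ r0 r1) (mm _ _ _ _ i0 i1))))
  (mm _ _ _ _ (cst t) (continuous_add (mm _ _ _ _ r0 i1)
    (mm _ _ _ _ (cst (- 1)) (mm _ _ _ _ i0 r1))))).
Qed.

Lemma hformZ p q s t (c : C) v :
  hform p q s t (c *: v) =
  (complex.Re (c : R[i]) ^+ 2 + complex.Im (c : R[i]) ^+ 2) * hform p q s t v.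
Proof.
rewrite /hform /coordRe /coordIm !mxE.
case: (c : R[i]) => a b; case: (v ord0 ord0 : R[i]) => x y.
by case: (v ord_max ord0 : R[i]) => z w /=; ring.
Qed.

Lemma hform11_gt0 v : (0 < hform 1 1 0 0 v) = (v != 0).
Proof.
have [->|] := eqVneq v 0.
  rewrite -(scale0r (0 : 'cV[C]_2)) hformZ.
  have [-> ->] : complex.Re (0 : R[i]) = 0 /\ complex.Im (0 : R[i]) = 0 by [].
  by rewrite expr0n /= addr0 mul0r ltxx.
move=> v0; rewrite lt0r; apply/andP; split; last first.
  by rewrite /hform !mul1r !mul0r !addr0 !addr_ge0// -expr2 sqr_ge0.
apply: contra v0; rewrite /hform !mul1r !mul0r !addr0 -!expr2.
rewrite paddr_eq0 ?addr_ge0 ?sqr_ge0// !paddr_eq0 ?sqr_ge0// !sqrf_eq0.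
move=> /andP[/andP[/eqP r0 /eqP i0] /andP[/eqP r1 /eqP i1]].
apply/eqP/matrixP => i j; rewrite (ord1 j) mxE.
have /orP[/eqP->|/eqP->] : (i == ord0) || (i == ord_max) by case: i => -[|[]].
  by apply/eqP; rewrite eq_complex -/(coordRe _ _) -/(coordIm _ _) r0 i0 /= eqxx.
by apply/eqP; rewrite eq_complex -/(coordRe _ _) -/(coordIm _ _) r1 i1 /= eqxx.
Qed.

(** The value does not depend on the choice of the vector [vpick L] in a line
    ([ray_form_vline]). *)
Definition ray_form (p q s t : R) L : R :=
  hform p q s t (vpick L) / hform 1 1 0 0 (vpick L).

Lemma ray_form_vline p q s t v : v != 0 ->
  ray_form p q s t (<[v]>%VS : {vspace _}) = hform p q s t v / hform 1 1 0 0 v.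
Proof.
move=> v0; have /vlineP[c vc] := memv_pick <[v]>%VS; rewrite /ray_form vc !hformZ.
have c0 : complex.Re (c : R[i]) ^+ 2 + complex.Im (c : R[i]) ^+ 2 != 0.
  have : vpick <[v]>%VS != 0 by rewrite vpick0 -dimv_eq0 dim_vline v0.
  by rewrite -hform11_gt0 vc hformZ => /gt_eqF/negbT; rewrite mulf_eq0 => /norP[].
by rewrite -mulf_div divff// mul1r.
Qed.

Lemma dim_colspan (k : nat) (M : 'M[C]_(2, k)) : \rank M = k ->
  \dim (colspan M : {vspace _}) = k.
Proof.
move=> rM; rewrite /colspan limg_dim_eq ?dimvf; first by rewrite /dim /= muln1.
have /row_fullP[B BM] : row_full M by rewrite -col_leq_rank rM.
apply/eqP; rewrite capfv; apply/lker0P => u w; rewrite !lfunE/=.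
by move=> /(congr1 (mulmx B)); rewrite !mulmxA BM !mul1mx.
Qed.

Lemma colspan_vline v : v != 0 -> colspan v = <[v]>%VS.
Proof.
move=> v0; apply/esym/eqP; rewrite eqEdim dim_vline v0 dim_colspan; last first.
  by rewrite -mxrank_tr rank_rV trmx_eq0 v0.
rewrite andbT -memvE; apply/memv_imgP; exists 1%:M; first exact: memvf.
by rewrite lfunE/= mulmx1.
Qed.

(** The inequality r < A / |.|^2 between quotients of Hermitian forms says that the
    single form A - r |.|^2 is positive, which is an open condition on a spanning
    vector.  In the charts with k different from 1 the set is empty. *)
Lemma open_ray_form (p q s t r : R) :
  @grassmannian_open R[i] 2 [set L | \dim (L : {vspace _}) = 1%N /\ r < ray_form p q s t L].
Proof.
move=> k; have [->|k1] := eqVneq k 1%N; last first.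
  rewrite [X in open X](_ : _ = set0); first exact: open0.
  apply/seteqP; split => M //= [rM [dM _]].
  by move: k1; rewrite -dM dim_colspan// eqxx.
rewrite [X in open X](_ : _ = [set v | 0 < hform 1 1 0 0 v] `&`
    [set v | 0 < hform (p - r) (q - r) s t v]).
  by apply: openI; apply: (@open_comp _ _ _ [set x : R | 0 < x]) => [? _|];
    [exact: continuous_hform|exact: open_gt|exact: continuous_hform|exact: open_gt].
have ratio v : v != 0 -> (r < ray_form p q s t (colspan v)) =
    (0 < hform (p - r) (q - r) s t v).
  move=> v0; rewrite colspan_vline// ray_form_vline//.
  rewrite ltr_pdivlMr ?hform11_gt0// -subr_gt0; congr (_ < _).
  by rewrite /hform; ring.
apply/seteqP; split => v /=; rewrite hform11_gt0.
  move=> [rv [_ rf]]; have v0 : v != 0.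
    by apply: contra_eqN rv => /eqP ->; rewrite mxrank0.
  by rewrite -ratio.
move=> [v0]; rewrite -ratio// => rf.
have rv : \rank v = 1%N by rewrite -mxrank_tr rank_rV trmx_eq0 v0.
by rewrite dim_colspan.
Qed.

Lemma open_lines : @grassmannian_open R[i] 2 [set L | \dim (L : {vspace _}) = 1%N].
Proof.
rewrite [X in grassmannian_open X](_ : _ =
  [set L | \dim (L : {vspace _}) = 1%N /\ -1 < ray_form 0 0 0 0 L]).
  exact: open_ray_form.
apply/seteqP; split => L /= [] //; split=> //.
by rewrite /ray_form /hform !mul0r !addr0 mul0r ltrN10.
Qed.

Lemma measurable_ray_form d (X : measurableType d) (E D : set X)
    (W : X -> borel_grassmannian R[i] 2) (p q s t : R) :
  E `<=` D -> measurable E -> measurable D -> measurable_fun D W ->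
  (forall x, E x -> \dim (W x : {vspace _}) = 1%N) ->
  measurable_fun E (fun x => ray_form p q s t (W x)).
Proof.
move=> ED mE mD mW dimW.
apply: (measurability _ (RGenOInfty.measurableE R)) => // _ [_ [r ->] <-].
pose Y : set (borel_grassmannian R[i] 2) :=
  [set L | \dim (L : {vspace _}) = 1%N /\ r < ray_form p q s t L].
have mY : measurable Y by apply: sub_sigma_algebra; exact: open_ray_form.
rewrite (_ : _ `&` _ = E `&` (D `&` W @^-1` Y)).
  by apply: measurableI => //; exact: mW.
apply/seteqP; split => x /=; rewrite in_itv/= andbT.
  by move=> [Ex rx]; split=> //; split; [exact: ED|split; [exact: dimW|]].
by move=> [Ex [_ [_ rx]]].
Qed.
End Bloch.

(** * Bloch vectors along an orbit *)

Lemma sum_wave_neq0 (R : realType) (u : nat -> R) (n : nat) : odd n ->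
  \sum_(j < n) wave (u j) != 0.
Proof.
move=> on; have [k ->] : exists k : int, \sum_(j < n) wave (u j) = n%:Z + 2 * k.
  elim: n {on} => [|n [k IH]]; first by exists 0; rewrite big_ord0.
  rewrite big_ord_recr/= IH; have [->|->] := wave_sign (u n).
    by exists k; lia.
  by exists (k - 1); lia.
by apply/eqP; move: on; lia.
Qed.

Lemma floor_unique (R : realType) (t : R) (n : int) : n%:~R <= t -> t < n%:~R + 1 ->
  Num.floor t = n.
Proof. by move=> nt tn; apply: floor_def; rewrite nt intrD. Qed.

Lemma iter_rotation (R : realType) (eta x : R) (n : nat) : 0 <= x < 1 ->
  iter n (rotation eta) x = x + n%:R * eta - (Num.floor (x + n%:R * eta))%:~R.
Proof.
move=> /andP[x0 x1]; elim: n => [|n IH]; first by rewrite /= mul0r addr0 (@floor_unique _ _ 0) ?subr0// add0r.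
rewrite iterS IH /rotation -natr1 mulrDl mul1r addrA.
set t := x + _; rewrite (_ : t - _ + eta = t + eta + (- Num.floor t)%:~R); last first.
  by rewrite rmorphN/=; ring.
have -> : Num.floor (t + eta + (- Num.floor t)%:~R) = Num.floor (t + eta) - Num.floor t.
  have /andP[tl tu] := floor_itv (t + eta); rewrite intrD in tu.
  by apply: floor_unique; rewrite rmorphB rmorphN/=; lra.
by rewrite rmorphB rmorphN/=; ring.
Qed.

Section Twisted.
Variables (R : realType) (eta phi : R) (G : set R) (f1 f2 f3 : R -> R).
Hypothesis eta01 : 0 < eta < 1.
Hypothesis G01 : G `<=` `[0, 1[.
Hypothesis GT : forall x, G x -> G (rotation eta x).
Hypothesis rot : forall x, G x -> x < 1 - eta ->
  [/\ f1 (rotation eta x) = cos phi * f1 x - sin phi * f2 x,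
      f2 (rotation eta x) = sin phi * f1 x + cos phi * f2 x &
      f3 (rotation eta x) = f3 x].
Hypothesis refl : forall x, G x -> 1 - eta <= x ->
  [/\ f1 (rotation eta x) = f1 x, f2 (rotation eta x) = - f2 x &
      f3 (rotation eta x) = - f3 x].

(** The number M of turns by phi after n steps.  When the orbit passes an integer
    the reflection leaves (f1, w f2) unchanged, while the sum of the waves grows by
    w; these terms alternate 1, -1, 1, and so on, so they contribute 1 when the
    number of reflections is odd and 0 otherwise. *)
Definition turns (x : R) (n : nat) : int :=
  \sum_(j < n) wave (x + j%:R * eta) - (wave (x + n%:R * eta) == -1)%:Z.

(** Multiplying f2 by w makes the reflections disappear: in the coordinates
    (f1, w f2) a rotation step becomes a turn by w phi and a reflection step the
    identity. *)
Lemma bloch_iter x n : G x ->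
  let w : R := (wave (x + n%:R * eta))%:~R in
  let psi : R := (turns x n)%:~R * phi in
  let y := iter n (rotation eta) x in
  [/\ G y, f1 y = cos psi * f1 x - sin psi * f2 x,
      w * f2 y = sin psi * f1 x + cos psi * f2 x & f3 y = w * f3 x].
Proof.
move=> Gx /=; have x01 : 0 <= x < 1 by have := G01 Gx; rewrite /= in_itv.
have /andP[eta0 eta1] := eta01.
elim: n => [|n [Gy e1 e2 e3]].
  have w1 : wave (x + 0%:R * eta) = 1.
    by rewrite /wave (@floor_unique _ _ 0) ?mul0r ?addr0 ?expr0z//; lra.
  by rewrite /turns big_ord0 w1 /= subr0 !mul0r cos0 sin0 !mul1r !mul0r subr0 add0r.
set y := iter n _ x in Gy e1 e2 e3 *; set t := x + n%:R * eta in e2 e3 *.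
have tE : x + n.+1%:R * eta = t + eta by rewrite /t -natr1; ring.
have yE : y = t - (Num.floor t)%:~R by exact: iter_rotation.
have /andP[tl tu] := floor_itv t.
rewrite intrD in tu.
rewrite iterS -/y /turns tE big_ord_recr/= -/t.
have [yl|yr] := ltP y (1 - eta).
  have wE : wave (t + eta) = wave t by rewrite /wave (@floor_unique _ _ (Num.floor t))//; lra.
  have [r1 r2 r3] := rot Gy yl.
  rewrite wE addrAC -/(turns x n) rmorphD/= mulrDl; split.
  - exact: GT.
  - rewrite r1 e1; move: e2; have [->|->] := wave_sign t.
      by rewrite !mul1r => ->; rewrite cosD sinD; ring.
    rewrite mulN1r mulN1r => /(congr1 -%R); rewrite opprK => ->.
    by rewrite cosB sinB; ring.
  - rewrite r2 e1; move: e2; have [->|->] := wave_sign t.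
      by rewrite !mul1r => ->; rewrite cosD sinD; ring.
    rewrite mulN1r mulN1r => /(congr1 -%R); rewrite opprK => ->.
    by rewrite mulN1r cosB sinB; ring.
  - by rewrite r3.
have wE : wave (t + eta) = - wave t.
  have fE : Num.floor (t + eta) = Num.floor t + 1 by apply: floor_unique; rewrite intrD; lra.
  by rewrite /wave fE exprzDr// mulrN1.
have [r1 r2 r3] := refl Gy yr.
have -> : \sum_(i < n) wave (x + i%:R * eta) + wave t - (wave (t + eta) == -1)%:Z
    = turns x n.
  by rewrite /turns -/t wE; have [->|->] := wave_sign t; rewrite /=; lia.
rewrite wE rmorphN/= r1 r2 r3 mulrNN e3 mulNr; split=> //; exact: GT.
Qed.

Lemma iter_rotation_near x n (m : int) : `[0, 1[%classic x ->
  `[0, 1[%classic (x + (n%:R * eta - m%:~R)) ->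
  iter n (rotation eta) x = x + (n%:R * eta - m%:~R) /\ wave (x + n%:R * eta) = (-1) ^ m.
Proof.
rewrite /= !in_itv/= => x01 /andP[l u].
have fE : Num.floor (x + n%:R * eta) = m by apply: floor_unique; lra.
by rewrite iter_rotation// /wave fE; split=> //; ring.
Qed.

(** On a set E of positive measure where f1, f2, f3 vary by less than e, a return
    after q steps with q eta near an odd integer forces f3 to be small on E, and a
    return with q odd and q eta near an even integer forces the rotation of (f1, f2)
    by a nonzero bounded multiple of phi to move it by less than e in each
    coordinate, which the gap below 1 of the cosines excludes. *)
Lemma no_twisted_bloch : measurable G -> (0 < lebesgue_measure G)%E ->
  measurable_fun G f1 -> measurable_fun G f2 -> measurable_fun G f3 ->
  (forall x, G x -> f1 x ^+ 2 + f2 x ^+ 2 + f3 x ^+ 2 = 1) ->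
  irrational eta -> (forall B : nat, exists2 c : R, 0 < c &
    forall m : int, m != 0 -> `|m| <= B%:Z -> cos (m%:~R * phi) <= 1 - c) ->
  False.
Proof.
move=> mG G0 mf1 mf2 mf3 sphere irr gap.
have [c c0 cP] := gap 20%N.
(* The bound 1 / 3 gives f3 ^ 2 <= 1 / 4 on E, and then e ^ 2 <= c / 6 beats the
   squared displacement 2 (1 - cos) (1 - f3 ^ 2) >= 3 c / 2. *)
pose e : R := Num.min (1 / 3) (c / 2).
have e0 : 0 < e by rewrite lt_min; apply/andP; split; lra.
have e3 : e <= 1 / 3 by rewrite ge_min lexx.
have ec : e <= c / 2 by rewrite ge_min lexx orbT.
have [E1 [E1G mE1 E10 osc1]] := small_oscillation mG G0 mf1 e0.
have mf2' := measurable_funS mG E1G mf2.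
have [E2 [E21 mE2 E20 osc2]] := small_oscillation mE1 E10 mf2' e0.
have mf3' := measurable_funS mG (subset_trans E21 E1G) mf3.
have [E [E32 mE E0 osc3]] := small_oscillation mE2 E20 mf3' e0.
have EG x : E x -> G x by move=> /E32/E21/E1G.
have ED x : E x -> `[0, 1[%classic x by move=> /EG/G01.
have Efin : (lebesgue_measure E < +oo)%E.
  apply: (@le_lt_trans _ _ (lebesgue_measure `[0%R, 1%R[%classic)).
    by apply: le_measure; rewrite ?inE//; exact: measurable_itv.
  by rewrite lebesgue_measure_itv/= lte_fin ltr01 -EFinB ltry.
have [r r0 rE] := steinhaus mE E0 Efin.
have small3 z : E z -> `|f3 z| < 1 / 2.
  have [q [p pq]] := odd_numerator irr r0.
  have [x Ex Exd] := rE _ pq.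
  have [yE wE] := iter_rotation_near (ED x Ex) (ED _ Exd).
  have [_ _ _ f3E] := bloch_iter q (EG x Ex).
  move=> Ez; have := osc3 _ _ Ez Ex; have := osc3 _ _ Exd Ex.
  rewrite -yE f3E wE exprzDr// -exprz_exp (_ : (-1 : int) ^ 2 = 1)// exp1rz expr1z mul1r mulN1r.
  rewrite !ltr_norml; lra.
have [q [p [oq cop]]] : exists q p : nat, [/\ odd q, coprime p q,
    `|q%:R * eta - (2 * p)%:R| < Num.min r 1 & `|q%:R * eta - (2 * p)%:R| * q%:R <= 4].
  have irr2 : irrational (eta / 2).
    apply: contra_not irr => /rationalP[m [n bE]]; apply/rationalP.
    by exists (2 * m), n; rewrite rmorphM/= -mulrA -bE; lra.
  have eta2 : 0 < eta / 2 by have /andP[? _] := eta01; lra.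
  have s0 : 0 < Num.min r 1 / 2 by rewrite divr_gt0// lt_min r0 ltr01.
  have [q [p [oq cop d1 d2]]] := odd_denominator eta2 irr2 s0.
  have dE : q%:R * eta - (2 * p)%:R = 2 * (q%:R * (eta / 2) - p%:R).
    by rewrite natrM; field.
  exists q, p; rewrite dE normrM normr_nat; split=> //.
    by move: d1; rewrite ltr_pdivlMr// mulrC.
  by rewrite -mulrA; lra.
rewrite lt_min => /andP[dr d1] dq.
have [x Ex Exd] := rE _ dr.
have [yE wE] := iter_rotation_near (m := (2 * p)%:Z) (ED x Ex) (ED _ Exd).
have [_ f1E f2E _] := bloch_iter q (EG x Ex).
have w1 : wave (x + q%:R * eta) = 1.
  by rewrite wE -exprnP mulnC exprM sqrr_sign.
have q0 : (0 < q)%N by case: (q) oq.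
(* The number of reflections is even, so the number of turns is the full sum of
   the waves. *)
have tE : turns x q = \sum_(j < q) wave (x + j%:R * eta).
  by rewrite /turns w1 subr0.
have cosE : cos ((turns x q)%:~R * phi) <= 1 - c.
  apply: cP; rewrite tE; first exact: (sum_wave_neq0 (fun j => x + j%:R * eta) oq).
  by apply: (@denjoy_koksma_wave _ _ _ _ p) => //; [have := ED x Ex; rewrite /= in_itv|exact: ltW].
have := osc1 _ _ (E21 _ (E32 _ Exd)) (E21 _ (E32 _ Ex)).
have := osc2 _ _ (E32 _ Exd) (E32 _ Ex).
rewrite w1 mul1r in f2E; rewrite -[x + _]yE f1E f2E.
have := small3 _ Ex; have := sphere _ (EG _ Ex); have := cos2Dsin2 ((turns x q)%:~R * phi).
move: cosE; set C := cos _; set S := sin _; set a := f1 x; set b := f2 x; set d := f3 x.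
move=> CE CS abd d2 o2 o1.
have d4 : d ^+ 2 <= 1 / 4.
  by rewrite -real_normK ?num_real//; rewrite (_ : 1 / 4 = (1 / 2) ^+ 2); [rewrite ler_sqr ?nnegrE// ltW|field].
have sq u : `|u| < e -> u ^+ 2 <= c / 6.
  move=> ue; rewrite -real_normK ?num_real//.
  apply: (@le_trans _ _ (e * e)); first by rewrite expr2 ler_pM// ltW.
  by apply: (@le_trans _ _ (1 / 3 * (c / 2))); [rewrite ler_pM// ltW|lra].
have := sq _ o1; have := sq _ o2.
have key : (C * a - S * b - a) ^+ 2 + (S * a + C * b - b) ^+ 2
    = (C ^+ 2 + S ^+ 2 + 1 - 2 * C) * (a ^+ 2 + b ^+ 2) by ring.
have ab : 3 / 4 <= a ^+ 2 + b ^+ 2 by lra.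
have : 2 * c * (3 / 4) <= (C ^+ 2 + S ^+ 2 + 1 - 2 * C) * (a ^+ 2 + b ^+ 2).
  by rewrite CS; apply: ler_pM => //; lra.
rewrite -key; lra.
Qed.
End Twisted.

(** * The action of the generator and irreducibility *)

Lemma coord_real_mx2 (R : realType) (a b c d : R) (v : 'cV[R[i]]_2) :
  let w := map_mx (real_complex R) (mx2 a b c d) *m v in
  [/\ coordRe ord0 w = a * coordRe ord0 v + b * coordRe ord_max v,
      coordIm ord0 w = a * coordIm ord0 v + b * coordIm ord_max v,
      coordRe ord_max w = c * coordRe ord0 v + d * coordRe ord_max v &
      coordIm ord_max w = c * coordIm ord0 v + d * coordIm ord_max v].
Proof.
rewrite /coordRe /coordIm; split; rewrite !mxE !big_ord_recl big_ord0 !mxE /=;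
  rewrite (_ : lift ord0 ord0 = ord_max); try exact: val_inj;
  case: (v ord0 ord0) => x y; case: (v ord_max ord0) => z t /=; ring.
Qed.

(** With a = v0 + i v1 and b = v0 - i v1, the form f1 + i f2 is a conj b / |v|^2, and
    f3 is proportional to |b|^2 - |a|^2.  The rotation by theta multiplies a by
    exp (i theta) and b by exp (- i theta), which doubles the angle; the reflection
    exchanges a and b. *)
Lemma generator_rays (R : realType) (eta alpha x : R) (L : borel_grassmannian R[i] 2) :
  \dim (L : {vspace _}) = 1%N ->
  let phi := pi * alpha *+ 2 in
  let L' : borel_grassmannian R[i] 2 :=
    (linfun (mulmx (generator eta alpha x) : 'cV[R[i]]_2 -> 'cV[R[i]]_2) @: L)%VS in
  let f1 := ray_form 1 (-1) 0 0 in
  let f2 := ray_form 0 0 2 0 in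
  let f3 := ray_form 0 0 0 2 in
  [/\ \dim (L' : {vspace _}) = 1%N,
      x < 1 - eta -> [/\ f1 L' = cos phi * f1 L - sin phi * f2 L,
        f2 L' = sin phi * f1 L + cos phi * f2 L & f3 L' = f3 L] &
      1 - eta <= x -> [/\ f1 L' = f1 L, f2 L' = - f2 L & f3 L' = - f3 L]].
Proof.
move=> dL phi L' f1 f2 f3.
have [v v0 LE] : exists2 v, v != 0 & L = <[v]>%VS.
  have v0 : vpick (L : {vspace _}) != 0 by rewrite vpick0 -dimv_eq0 dL.
  exists (vpick (L : {vspace _})) => //; apply/esym/eqP.
  by rewrite eqEdim dim_vline v0 dL -memvE memv_pick.
have L'E : L' = <[generator eta alpha x *m v]>%VS.
  by rewrite /L' LE limg_line lfunE.
have n0 : hform 1 1 0 0 v != 0 by rewrite gt_eqF// hform11_gt0.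
have cs := cos2Dsin2 (pi * alpha).
rewrite L'E LE /f1 /f2 /f3.
rewrite dim_vline.
have [lt|ge] := ltP x (1 - eta).
  have gE : generator eta alpha x = map_mx (real_complex R)
    (mx2 (cos (pi * alpha)) (- sin (pi * alpha)) (sin (pi * alpha)) (cos (pi * alpha))).
    by rewrite /generator lt.
  have [w1 w2 w3 w4] := coord_real_mx2 (cos (pi * alpha)) (- sin (pi * alpha))
    (sin (pi * alpha)) (cos (pi * alpha)) v.
  rewrite -gE in w1 w2 w3 w4; set w := _ *m v in w1 w2 w3 w4 *.
  have wn : hform 1 1 0 0 w = hform 1 1 0 0 v.
    transitivity ((cos (pi * alpha) ^+ 2 + sin (pi * alpha) ^+ 2) * hform 1 1 0 0 v).
      by rewrite /hform w1 w2 w3 w4; ring.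
    by rewrite cs mul1r.
  have w0 : w != 0 by rewrite -hform11_gt0 wn hform11_gt0.
  rewrite w0; split=> // _; rewrite !ray_form_vline// wn /phi cos_mulr2n sin_mulr2n.
  set c := cos _ in cs w1 w2 w3 w4 *; set s := sin _ in cs w1 w2 w3 w4 *.
  have cE : c ^+ 2 *+ 2 - 1 = c ^+ 2 - s ^+ 2 by rewrite -cs; ring.
  rewrite cE; split; rewrite ?mulrA -?mulrBl -?mulrDl; congr (_ / _).
  - by rewrite /hform w1 w2 w3 w4; ring.
  - by rewrite /hform w1 w2 w3 w4; ring.
  - transitivity ((c ^+ 2 + s ^+ 2) * hform 0 0 0 2 v); last by rewrite cs mul1r.
    by rewrite /hform w1 w2 w3 w4; ring.
have gE : generator eta alpha x = map_mx (real_complex R) (mx2 1 0 0 (-1)).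
  by rewrite /generator ltNge ge.
have [w1 w2 w3 w4] := coord_real_mx2 1 0 0 (-1) v.
rewrite -gE in w1 w2 w3 w4; set w := _ *m v in w1 w2 w3 w4 *.
have wn : hform 1 1 0 0 w = hform 1 1 0 0 v.
  by rewrite /hform w1 w2 w3 w4; ring.
have w0 : w != 0 by rewrite -hform11_gt0 wn hform11_gt0.
rewrite w0; split=> // _; rewrite !ray_form_vline// wn.
by split; rewrite -?mulNr; congr (_ / _); rewrite /hform w1 w2 w3 w4; ring.
Qed.

Lemma bloch_sphere (R : realType) (L : borel_grassmannian R[i] 2) :
  \dim (L : {vspace _}) = 1%N ->
  ray_form 1 (-1) 0 0 L ^+ 2 + ray_form 0 0 2 0 L ^+ 2 + ray_form 0 0 0 2 L ^+ 2 = 1.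
Proof.
move=> dL; have v0 : vpick (L : {vspace _}) != 0 by rewrite vpick0 -dimv_eq0 dL.
have n0 : hform 1 1 0 0 (vpick (L : {vspace _})) != 0 by rewrite gt_eqF// hform11_gt0.
rewrite /ray_form; apply/eqP; rewrite !expr_div_n -!mulrDl.
rewrite -(inj_eq (mulIf (expf_neq0 2 n0))) mul1r divfK ?expf_neq0//.
by apply/eqP; rewrite /hform; ring.
Qed.

Lemma rotation_itv (R : realType) (eta x : R) : `[0, 1[%classic (rotation eta x).
Proof.
have /andP[l u] := floor_itv (x + eta); rewrite intrD in u.
by rewrite /= in_itv/= /rotation; lra.
Qed.

Lemma generator_inj (R : realType) (eta alpha x : R) :
  lker (linfun (mulmx (generator eta alpha x) : 'cV[R[i]]_2 -> 'cV[R[i]]_2)) == 0%VS.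
Proof.
rewrite -subv0; apply/subvP => v; rewrite memv_ker memv0 => /eqP gv.
apply: contrapT => /negP v0.
have dv : \dim <[v]>%VS = 1%N by rewrite dim_vline v0.
have [/= + _ _] := generator_rays eta alpha x dv.
by rewrite limg_line gv dim_vline eqxx.
Qed.

Lemma trivial_bundle_invariant (R : realType) (eta alpha : R) :
  invariant_bundle (@lebesgue_measure R) `[0, 1[ (rotation eta)
    (cocycle (rotation eta) (rotation (- eta)) (generator eta alpha))
    (@trivial_bundle R R[i] 2).
Proof.
split; first exact: measurable_cst.
exists `[0, 1[%classic; split => //.
- by rewrite setDv measure0.
- apply/seteqP; split => [x []//|x Dx]; split => //.
  exact: rotation_itv.
- by move=> x _; rewrite /cocycle /= mulmx1 (lker0_limgf (generator_inj _ _ _)).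
Qed.

Theorem proposition4p2 (R : realType) (eta alpha : R)
    (eta01 : 0 < eta < 1) (eta_irr : irrational eta)
    (alpha01 : 0 < alpha < 1) (alpha_irr : irrational alpha) :
  irreducible_bundle (@lebesgue_measure R) `[0, 1[ (rotation eta)
    (cocycle (rotation eta) (rotation (- eta)) (generator eta alpha))
    (@trivial_bundle R R[i] 2).
Proof.
split; first exact: trivial_bundle_invariant.
move=> [W [[mW [D' [D'D mD' D'0 TD' invW]]] [N [mN N0 NW]]]].
pose D : set R := `[0, 1[%classic.
have mD : measurable D by exact: measurable_itv.
pose lines : set (borel_grassmannian R[i] 2) := [set L | \dim (L : {vspace _}) = 1%N].
have mlines : measurable lines by apply: sub_sigma_algebra; exact: open_lines.
(* G is invariant because D' is and the generator is invertible. *)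
pose G : set R := D' `&` (D `&` W @^-1` lines).
have mG : measurable G by apply: measurableI => //; exact: mW.
have G0 : (0 < lebesgue_measure G)%E.
  rewrite lt_neqAle measure_ge0 andbT; apply/eqP => G0.
  have cover : D `<=` (G `|` N) `|` (D `\` D').
    move=> x Dx; have [D'x|nD'x] := pselect (D' x); last by right.
    have [Nx|nNx] := pselect (N x); first by left; right.
    left; left; split=> //; split=> //.
    have [W0 _ WT] : [/\ W x != 0%VS, (W x <= trivial_bundle R[i] 2 x)%VS &
        W x != trivial_bundle R[i] 2 x].
      apply: contrapT => nP; apply: nNx; apply: NW => /= /(_ Dx); exact: nP.
    have d2 : \dim {: 'cV[R[i]]_2} = 2 by rewrite dimvf /dim /= muln1.
    apply/eqP; rewrite /= eqn_leq lt0n dimv_eq0 W0 andbT -ltnS.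
    rewrite ltn_neqAle -[X in (_ <= X)%N]d2 dimvS ?subvf// andbT.
    by apply: contra WT => /eqP dW; rewrite eqEdim subvf [leqLHS]d2 dW.
  have : lebesgue_measure D = 0%E.
    apply/eqP; rewrite -measure_le0.
    have mGN : measurable (G `|` N) by exact: measurableU.
    have mDD' : measurable (D `\` D') by exact: measurableD.
    have le1 : (lebesgue_measure D <= lebesgue_measure ((G `|` N) `|` (D `\` D')))%E.
      by apply: le_measure; rewrite ?inE//; exact: measurableU.
    have le2 : (lebesgue_measure ((G `|` N) `|` (D `\` D')) <=
      lebesgue_measure (G `|` N) + lebesgue_measure (D `\` D'))%E by exact: measureU2.
    have le3 : (lebesgue_measure (G `|` N) <= lebesgue_measure G + lebesgue_measure N)%E.
      exact: measureU2.
    have DD'0 : lebesgue_measure (D `\` D') = 0%E by exact: D'0.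
    rewrite DD'0 adde0 in le2; rewrite -G0 N0 adde0 in le3.
    exact: le_trans le1 (le_trans le2 le3).
  rewrite lebesgue_measure_itv/= lte_fin ltr01.
  by move=> /eqP; rewrite -EFinB subr0 eqe oner_eq0.
have step x : G x -> W (rotation eta x) =
    (linfun (mulmx (generator eta alpha x) : 'cV[R[i]]_2 -> 'cV[R[i]]_2) @: W x)%VS.
  by move=> [D'x _]; have := invW _ D'x; rewrite /cocycle /= mulmx1 => ->.
have rays x (Gx : G x) := generator_rays eta alpha x (proj2 (proj2 Gx)).
have GD : G `<=` D by move=> x [_ []].
have mf p q s t : measurable_fun G (fun x => ray_form p q s t (W x)).
  by apply: (measurable_ray_form _ _ _ _ GD mG mD mW) => x [_ []].
have alpha0 : 0 < alpha by case/andP: alpha01.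
apply: (@no_twisted_bloch R eta (pi * alpha *+ 2) G
  (fun x => ray_form 1 (-1) 0 0 (W x)) (fun x => ray_form 0 0 2 0 (W x))
  (fun x => ray_form 0 0 0 2 (W x))) => //.
- move=> x Gx; have [dW _ _] := rays x Gx; split.
    have : (`[0, 1[%classic `&` rotation eta @^-1` D') x by rewrite TD'; case: Gx.
    by case.
  by split; [exact: rotation_itv|rewrite /= step].
- by move=> x Gx lt; have [_ /(_ lt) ? _] := rays x Gx; rewrite step.
- by move=> x Gx ge; have [_ _ /(_ ge) ?] := rays x Gx; rewrite step.
- by move=> x [_ [_ dW]]; exact: bloch_sphere.
- by move=> B; exact: cos_gap.
Qed.
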